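(* In the setting of the context, let $g\in L_+(H)^E$ be a $u$-based $s$,$d$-flow which also fulfills flow conservation at $s$. Then $g$ is a dynamic circulation: there exist zero-cycle inflow rates $h_c\in L_+(H)$, $c\in\mathcal C$, such that for all $e\in E$, $g_e=\sum_{c\in\mathcal C}\ell^u_{c,e}(h_c)=\sum_{c\in\mathcal C:\,e\in c}h_c$.
   Context: $G=(V,E)$ finite directed graph with source $s$ and destination $d$, every node connected to $s$; $\delta^\pm(v)$ edges leaving/entering $v$. $H=[0,t_f]$ with Borel $\sigma$-algebra $\mathcal B(H)$ and Lebesgue measure $\sigma$; $L(H)$ integrable real functions up to a.e. equality, $L_+(H)$ nonnegative ones. A walk is $w=(e_1,\dots,e_k)$, $e_j=(v_j,v_{j+1})\in E$, $w[j]=e_j$, $|w|=k$; a cycle is a walk whose first edge leaves and last edge enters the same node; it is simple if each node has at most one edge of the walk leaving it. $\mathcal C$ is the finite set of simple cycles. Fix $u\in L(H)^E$ with induced nonnegative absolutely continuous traversal times $D_e(u,\cdot)$ such that $T_e(u,t):=t+D_e(u,t)$ is nondecreasing; $A_{w,1}(u,\cdot)=\mathrm{id}$, $A_{w,j}(u,\cdot)=T_{w[j-1]}(u,\cdot)\circ\dots\circ T_{w[1]}(u,\cdot)$. Standing assumption: $u$ vanishes a.e. on $[t_f',t_f]$ for some $t_f'<t_f$ and all $A_{w,j}(u,\cdot)$ map $H$ into $H$. $\ell^u_{w,e}(h)$ denotes (if it exists) the function in $L(H)$ with $\int_0^t\ell^u_{w,e}(h)\,d\sigma=\sum_{j\le|w|:w[j]=e}\int_{A_{w,j}(u,\cdot)^{-1}([0,t])}h\,d\sigma$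 for all $t$. An inflow rate $h_c\in L_+(H)$ into a cycle $c$ is a zero-cycle inflow rate if for almost all $t$, $h_c(t)>0$ implies $D_e(u,t)=0$ for all edges $e$ of $c$. Node balance: $\nabla^u_v g(\mathfrak T):=\sum_{e\in\delta^+(v)}\int_{\mathfrak T}g_e\,d\sigma-\sum_{e\in\delta^-(v)}\int_{T_e(u,\cdot)^{-1}(\mathfrak T)}g_e\,d\sigma$. $g$ has net outflow rate $r_v$ at $v$ if $\nabla^u_v g(\mathfrak T)=\int_{\mathfrak T}r_v\,d\sigma$ for all $\mathfrak T\in\mathcal B(H)$; flow conservation at $v$ means $r_v=0$. A $u$-based $s$,$d$-flow is $g\in L_+(H)^E$ with a net outflow rate $r_s\in L_+(H)$ at $s$, flow conservation at all $v\notin\{s,d\}$, and $\nabla^u_d g(\mathfrak T)\le0$ for all $\mathfrak T$. *)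

(* Defs.v *)
From mathcomp Require Import all_boot all_order all_algebra.
From mathcomp Require Import all_classical all_reals all_analysis.

Set Implicit Arguments.
Unset Strict Implicit.
Unset Printing Implicit Defensive.

Import Order.TTheory GRing.Theory Num.Theory.
Import numFieldNormedType.Exports.

Local Open Scope classical_set_scope.
Local Open Scope ring_scope.

(* Parallel edges and loops are allowed; a graph with edge set [E] contained in
   [V * V] is the case where [tail] and [head] are the two projections. *)
Record digraph := Digraph {
  node : finType;
  edge : finType;
  tail : edge -> node;
  head : edge -> node
}.

Definition consecutive (G : digraph) : rel (edge G) :=
  fun e e' => head e == tail e'.

Definition is_walk (G : digraph) (w : seq (edge G)) : bool :=
  sorted (@consecutive G) w.

Definition is_cycle (G : digraph) (w : seq (edge G)) : bool :=
  if w is e :: p then is_walk w && (tail e == head (last e p)) else false.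

(* Positions of the walk are counted, so an edge used twice counts twice. *)
Definition is_simple_cycle (G : digraph) (w : seq (edge G)) : bool :=
  is_cycle w && [forall v, (count (fun e => tail e == v) w <= 1)%N].

(* The bound on the length only serves to get a finite type. *)
Lemma size_simple_cycle (G : digraph) (w : seq (edge G)) :
  is_simple_cycle w -> (size w <= #|node G|)%N.
Proof.
move=> /andP[_ /forallP w1].
have uw : uniq [seq tail e | e <- w].
  apply/count_mem_uniq => v; move: (w1 v).
  rewrite -has_pred1 has_count count_map.
  rewrite (eq_count (a2 := fun e => tail e == v)) //.
  by case: (count _ w) => [|[|?]].
by rewrite -(size_map (@tail G)) -(card_uniqP uw) max_card.
Qed.

Definition simple_cycles (G : digraph) : {set {bseq #|node G| of edge G}} :=
  [set c : {bseq #|node G| of edge G} | is_simple_cycle c]%SET.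

Definition reachable (G : digraph) (v v' : node G) : bool :=
  connect [rel x y | [exists e : edge G, (tail e == x) && (head e == y)]] v v'.

Definition horizon (R : realType) (tf : R) : set R := [set t | 0 <= t <= tf].

Definition ae_on (R : realType) (tf : R) (P : R -> Prop) : Prop :=
  {ae @lebesgue_measure R, forall t, horizon tf t -> P t}.

(* Elements of [L(H)] are handled through representatives [R -> R], whose values
   outside [H] are irrelevant; equality in [L(H)] is equality a.e. on [H]. *)
Definition in_L (R : realType) (tf : R) (f : R -> R) : Prop :=
  (@lebesgue_measure R).-integrable (horizon tf) (EFin \o f).

Definition in_Lplus (R : realType) (tf : R) (f : R -> R) : Prop :=
  in_L tf f /\ ae_on tf (fun t => 0 <= f t).

Definition absolutely_continuous_on (R : realType) (a b : R) (f : R -> R) :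
    Prop :=
  forall eps : R, 0 < eps -> exists2 delta : R, 0 < delta &
    forall (n : nat) (x y : 'I_n -> R),
      (forall i, a <= x i /\ x i <= y i /\ y i <= b) ->
      trivIset [set: 'I_n] (fun i => [set t | x i < t < y i]) ->
      \sum_(i < n) (y i - x i) < delta ->
      \sum_(i < n) `|f (y i) - f (x i)| < eps.

(* From here on [D] stands for the family [D_e(u, .)] at the fixed [u]. *)

Definition exit_time (R : realType) (G : digraph) (D : edge G -> R -> R)
    (e : edge G) (t : R) : R := t + D e t.

(* Positions in a walk are counted from 0: [arrival D w j] is
   [A_{w,j+1}], the composition of the exit times of the first [j] edges. *)
Definition arrival (R : realType) (G : digraph) (D : edge G -> R -> R)
    (w : seq (edge G)) (j : nat) (t : R) : R :=
  foldl (fun t' e => exit_time D e t') t (take j w).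

(* The preimage of [B] under [phi] regarded as a function on [H]. *)
Definition preimage_on (R : realType) (tf : R) (phi : R -> R) (B : set R) :
    set R :=
  horizon tf `&` phi @^-1` B.

(* [l] is (a representative of) the edge flow [l^u_{w,e}(h)]; it is unique up to
   a.e. equality. The default value [e] of [nth] is never used. *)
Definition is_edge_flow (R : realType) (G : digraph) (tf : R)
    (D : edge G -> R -> R) (w : seq (edge G)) (e : edge G) (h l : R -> R) :
    Prop :=
  in_L tf l /\
  forall t, horizon tf t ->
    \int[lebesgue_measure]_(x in [set x : R | (0 <= x <= t)%R]) l x =
    \sum_(j < size w | nth e w j == e)
      \int[lebesgue_measure]_(x in
         preimage_on tf (arrival D w j) [set x : R | (0 <= x <= t)%R]) h x.

Definition zero_cycle_inflow (R : realType) (G : digraph) (tf : R)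
    (D : edge G -> R -> R) (c : seq (edge G)) (h : R -> R) : Prop :=
  in_Lplus tf h /\
  ae_on tf (fun t => 0 < h t -> forall e, e \in c -> D e t = 0).

Definition node_balance (R : realType) (G : digraph) (tf : R)
    (D : edge G -> R -> R) (g : edge G -> R -> R) (v : node G) (B : set R) :
    R :=
  \sum_(e : edge G | tail e == v) \int[lebesgue_measure]_(x in B) g e x -
  \sum_(e : edge G | head e == v)
    \int[lebesgue_measure]_(x in preimage_on tf (exit_time D e) B) g e x.

Definition has_net_outflow (R : realType) (G : digraph) (tf : R)
    (D : edge G -> R -> R) (g : edge G -> R -> R) (v : node G) (r : R -> R) :
    Prop :=
  forall B : set R, measurable B -> B `<=` horizon tf ->
    node_balance tf D g v B = \int[lebesgue_measure]_(x in B) r x.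

Definition flow_conservation (R : realType) (G : digraph) (tf : R)
    (D : edge G -> R -> R) (g : edge G -> R -> R) (v : node G) : Prop :=
  has_net_outflow tf D g v (fun=> 0).

Definition is_sd_flow (R : realType) (G : digraph) (tf : R)
    (D : edge G -> R -> R) (s d : node G) (g : edge G -> R -> R) : Prop :=
  [/\ forall e, in_Lplus tf (g e),
      exists2 rs : R -> R, in_Lplus tf rs & has_net_outflow tf D g s rs,
      forall v, v != s -> v != d -> flow_conservation tf D g v
    & forall B : set R, measurable B -> B `<=` horizon tf ->
        node_balance tf D g d B <= 0].

(* Main.v *)
Require Import Defs.
From mathcomp Require Import all_boot all_order all_algebra.
From mathcomp Require Import all_classical all_reals all_analysis measurable_realfun.

(** Summed over all nodes, the balances on [[0, t]] give the flow in transit at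
    time [t]; as it is nonpositive, no flow is ever in transit, so almost
    everywhere an edge carries flow only while its traversal time is zero. There
    the flow is a static circulation for almost every [t], and it is decomposed
    pointwise and greedily: running through the simple cycles in a fixed order,
    subtract from the edges of each one the least residual flow on it. Afterwards
    every simple cycle has an edge without residual flow, which forces the residual
    circulation to vanish. The amount subtracted along a cycle is a finite
    composition of differences and minima, hence measurable in [t]. *)

Set Implicit Arguments.
Unset Strict Implicit.
Unset Printing Implicit Defensive.

Import Order.TTheory GRing.Theory Num.Theory.
Import numFieldNormedType.Exports.
(* Undoes the shadowing of [head] by the head of a sequence. *)
Import Defs.

Local Open Scope classical_set_scope.
Local Open Scope ring_scope.

(** * Static circulations and the node counts of simple cycles *)

Definition static_circulation (R : realDomainType) (G : digraph)
    (f : edge G -> R) : Prop :=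
  forall v, \sum_(e | tail e == v) f e = \sum_(e | head e == v) f e.

Lemma uniq_tail_simple_cycle (G : digraph) (c : seq (edge G)) :
  is_simple_cycle c -> uniq [seq tail e | e <- c].
Proof.
case/andP=> _ /forallP c1; apply/count_mem_uniq => v; move: (c1 v).
rewrite -has_pred1 has_count count_map.
rewrite (eq_count (a2 := fun e => tail e == v)) //.
by case: (count _ c) => [|[|?]].
Qed.

(** Along a closed walk each head is the next tail, and the last head is the first tail: the two
    lists differ by a rotation. *)
Lemma perm_head_tail_cycle (G : digraph) (c : seq (edge G)) :
  is_cycle c -> perm_eq [seq head e | e <- c] [seq tail e | e <- c].
Proof.
case: c => // e p /andP[wp /eqP eclosed].
suff -> : [seq head e' | e' <- e :: p] =
          rcons [seq tail e' | e' <- p] (head (last e p)).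
  by rewrite -eclosed /= perm_rcons.
move: wp; rewrite /is_walk /= {eclosed}.
elim: p e => [|e' p IHp] e //= /andP[/eqP -> wp].
by rewrite -IHp.
Qed.

(** * Greedy decomposition of a static circulation into simple cycles *)

Section Peeling.
Variables (R : realDomainType) (G : digraph).
Implicit Types (f : edge G -> R) (c : seq (edge G)) (cs : seq (seq (edge G))).

(** The iterated minimum needs a starting value, which the first edge provides. The value at [[::]]
    is a mere default, as no simple cycle is empty. *)
Definition bottleneck f c : R :=
  if c is e :: p then \big[Num.min/f e]_(e' <- p) f e' else 0.

Lemma bottleneck_le f c e : e \in c -> bottleneck f c <= f e.
Proof.
case: c => // e0 p; rewrite inE => /predU1P[->|ep]; first exact: bigmin_le_id.
exact: ge_bigmin_seq.
Qed.

Lemma bottleneck_ge0 f c : (forall e, 0 <= f e) -> 0 <= bottleneck f c.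
Proof. by case: c => //= e p f0; apply: le_bigmin. Qed.

Lemma bottleneck_attained f c :
  c != [::] -> exists2 e, e \in c & bottleneck f c = f e.
Proof.
case: c => // e0 p _ /=; elim: p => [|e p [e' e'p eqe']].
  by exists e0; rewrite ?mem_head ?big_nil.
rewrite big_cons {}eqe' minEle; case: ifP => _.
  by exists e; rewrite // !inE eqxx orbT.
by exists e' => //; move: e'p; rewrite !inE => /orP[|] ->; rewrite ?orbT.
Qed.

Definition peel f c : edge G -> R :=
  fun e => f e - (if e \in c then bottleneck f c else 0).

Definition remainder cs f : edge G -> R := foldl peel f cs.

(** The bottleneck of [c] is taken in the residual left by its predecessors in the list. Only the
    first occurrence of [c] counts, hence the [uniq cs] required below. *)
Fixpoint peeled cs f c : R :=
  if cs is c0 :: cs' then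
    if c == c0 then bottleneck f c0 else peeled cs' (peel f c0) c
  else 0.

Lemma peel_ge0 f c : (forall e, 0 <= f e) -> forall e, 0 <= peel f c e.
Proof.
move=> f0 e; rewrite /peel; case: ifPn => ec; last by rewrite subr0.
by rewrite subr_ge0 bottleneck_le.
Qed.

Lemma peel_le f c : (forall e, 0 <= f e) -> forall e, peel f c e <= f e.
Proof.
move=> f0 e; rewrite /peel gerBl; case: ifP => // _; exact: bottleneck_ge0.
Qed.

Lemma remainder_ge0 cs f :
  (forall e, 0 <= f e) -> forall e, 0 <= remainder cs f e.
Proof.
by elim: cs f => //= c cs IHcs f f0; apply: IHcs; apply: peel_ge0.
Qed.

Lemma remainder_le cs f :
  (forall e, 0 <= f e) -> forall e, remainder cs f e <= f e.
Proof.
elim: cs f => //= c cs IHcs f f0 e.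
by apply: le_trans (IHcs _ (peel_ge0 c f0) e) (peel_le c f0 e).
Qed.

(** At the turn of [c], an edge attaining its minimum drops to zero. Later steps can only lower this
    value and keep it nonnegative. *)
Lemma remainder_vanishes cs f c : (forall e, 0 <= f e) ->
  c \in cs -> c != [::] -> exists2 e, e \in c & remainder cs f e = 0.
Proof.
elim: cs f => //= c0 cs IHcs f f0; rewrite inE => /predU1P[-> c00|ccs c0N].
  have [e ec0 eqf] := bottleneck_attained f c00; exists e => //.
  apply/eqP; rewrite eq_le remainder_ge0 ?andbT; last exact: peel_ge0.
  apply: le_trans (remainder_le cs (peel_ge0 c0 f0) e) _.
  by rewrite /peel ec0 eqf subrr.
by apply: IHcs => //; apply: peel_ge0.
Qed.

Lemma peeled_ge0 cs f c : (forall e, 0 <= f e) -> 0 <= peeled cs f c.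
Proof.
elim: cs f => //= c0 cs IHcs f f0; case: ifP => _; first exact: bottleneck_ge0.
by apply: IHcs; apply: peel_ge0.
Qed.

(** Residuals never increase. In the theorem this bound gives both the integrability of the inflow
    rates and the passage from inflow on a cycle to flow on all its edges. *)
Lemma peeled_le cs f c e :
  (forall e, 0 <= f e) -> e \in c -> peeled cs f c <= f e.
Proof.
move=> + ec; elim: cs f => //= c0 cs IHcs f f0.
case: eqP => [<-|_]; first exact: bottleneck_le.
by apply: le_trans (IHcs _ (peel_ge0 c0 f0)) (peel_le c0 f0 e).
Qed.

Lemma sum_peeled cs f e : uniq cs ->
  f e = remainder cs f e + \sum_(c <- cs | e \in c) peeled cs f c.
Proof.
elim: cs f => [|c0 cs IHcs] f /=; first by rewrite big_nil addr0.
case/andP=> c0cs ucs; rewrite big_cons eqxx.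
have -> : \sum_(c <- cs | e \in c)
            (if c == c0 then bottleneck f c0 else peeled cs (peel f c0) c) =
          \sum_(c <- cs | e \in c) peeled cs (peel f c0) c.
  rewrite big_seq_cond [RHS]big_seq_cond; apply: eq_bigr => c /andP[ccs _].
  by case: eqP => // cc0; rewrite -cc0 ccs in c0cs.
have := IHcs (peel f c0) ucs; rewrite {1}/peel.
case: ifP => _ /eqP; last by rewrite subr0 => /eqP.
by rewrite subr_eq => /eqP ->; rewrite -addrA (addrC (\sum_(_ <- _ | _) _)).
Qed.

(** The same amount is subtracted once per edge of [c], and [c] leaves each node as often as it
    enters it. *)
Lemma peel_circulation f c :
  is_simple_cycle c -> static_circulation f -> static_circulation (peel f c).
Proof.
move=> sc fcirc v; rewrite /peel !sumrB fcirc; congr (_ - _).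
have uc : uniq c := map_uniq (uniq_tail_simple_cycle sc).
have count_sum (p : edge G -> node G) :
    \sum_(e | p e == v) (if e \in c then bottleneck f c else 0) =
    bottleneck f c *+ count_mem v [seq p e | e <- c].
  rewrite -big_mkcondr /= (eq_bigl (fun e => (e \in c) && (p e == v))).
    rewrite big_mkcondr /= -big_uniq // -big_mkcond big_const_seq iter_addr_0.
    by rewrite count_map.
  by move=> e; rewrite andbC.
rewrite !count_sum; congr (_ *+ _); apply/esym/permP.
by case/andP: sc => cc _; apply: perm_head_tail_cycle.
Qed.

Lemma remainder_circulation cs f : {in cs, forall c, is_simple_cycle c} ->
  static_circulation f -> static_circulation (remainder cs f).
Proof.
elim: cs f => //= c cs IHcs f cs_simple fcirc; apply: IHcs.
  by move=> c' c'cs; apply: cs_simple; rewrite inE c'cs orbT.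
by apply: peel_circulation => //; apply: cs_simple; rewrite mem_head.
Qed.

(** By conservation, the head of an edge with positive flow has an outgoing edge with positive flow.
    Following such edges in a finite graph runs into a loop of distinct nodes. *)
Lemma active_simple_cycle f e0 : (forall e, 0 <= f e) ->
  static_circulation f -> 0 < f e0 ->
  exists2 c, is_simple_cycle c & {in c, forall e, 0 < f e}.
Proof.
move=> f0 fcirc fe0.
pose active v := [exists e, (tail e == v) && (0 < f e)].
(* The default [e0] is never reached at active nodes, the only ones visited. *)
pose out v := odflt e0 [pick e | (tail e == v) && (0 < f e)].
pose next v := head (out v).
have outP v : active v -> tail (out v) = v /\ 0 < f (out v).
  rewrite /out; case: pickP => [e /andP[/eqP ? ?] //|noe /existsP[e]].
  by rewrite noe.
(* Otherwise no flow leaves [next v], hence none enters it, although [out v] does. *)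
have active_next v : active v -> active (next v).
  case/outP=> _ fv; apply: contraT; rewrite negb_exists => /forallP noout.
  have : \sum_(e | head e == next v) f e = 0.
    rewrite -fcirc; apply: big1 => e te; apply/eqP; move: (noout e).
    by rewrite te /= lt_def f0 andbT negbK.
  move/eqP; rewrite psumr_eq0 // => /allP /(_ (out v)).
  by rewrite mem_index_enum eqxx /= => /(_ isT); rewrite gt_eqF.
have active_iter k v : active v -> active (iter k next v).
  by move=> av; elim: k => //= k; apply: active_next.
have av0 : active (tail e0) by apply/existsP; exists e0; rewrite eqxx.
(* The orbit of [tail e0] first repeats by returning to its point of rank [i]. So [v] lies on the
   loop, whose length is [n]. *)
have [i ilt iterE] := trajectP (looping_order next (tail e0)).
set n := (fingraph.order next (tail e0) - i)%N; set v := iter i next (tail e0).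
have n_gt0 : (0 < n)%N by rewrite subn_gt0.
have av : active v by apply: active_iter.
have iter_v : iter n next v = v.
  by rewrite /v -iterD subnK // ltnW.
have utraj : uniq (traject next v n).
  (* The loop is a final segment of the orbit, whose points are distinct. *)
  have := orbit_uniq next (tail e0).
  rewrite /orbit -[X in traject _ _ X](subnKC (ltnW ilt)) trajectD.
  by rewrite cat_uniq => /and3P[].
have active_traj : {in traject next v n, forall x, active x}.
  by move=> _ /trajectP[k _ ->]; apply: active_iter.
have tail_out : [seq tail e | e <- [seq out x | x <- traject next v n]] =
                traject next v n.
  rewrite -map_comp -[RHS]map_id; apply/eq_in_map => x xt /=.
  by have [] := outP x (active_traj x xt).
exists [seq out x | x <- traject next v n]; last first.
  by move=> _ /mapP[x xt ->]; have [] := outP x (active_traj x xt).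
apply/andP; split; last first.
  apply/forallP => x; rewrite -(count_map (@tail G) (pred1 x)) tail_out.
  by rewrite count_uniq_mem // leq_b1.
clear active_traj tail_out utraj.
case: n n_gt0 iter_v => // n _ iter_v; rewrite /= last_map last_traject.
apply/andP; split; last first.
  by rewrite (proj1 (outP v av)) -[X in X == _]iter_v.
rewrite /is_walk /=; move: v av {iter_v} => v.
elim: n v => //= n IHn v av; rewrite {1}/consecutive.
by rewrite (proj1 (outP _ (active_next v av))) eqxx IHn //; apply: active_next.
Qed.

(** A nonzero remainder would be positive along some simple cycle; but that cycle is in [cs], so one
    of its edges has been exhausted. *)
Lemma peeled_decomposition cs f e : uniq cs -> cs =i @is_simple_cycle G ->
  (forall e, 0 <= f e) -> static_circulation f ->
  f e = \sum_(c <- cs | e \in c) peeled cs f c.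
Proof.
move=> ucs csE f0 fcirc.
suff rem0 : remainder cs f e = 0 by rewrite {1}(sum_peeled f e ucs) rem0 add0r.
apply/eqP; rewrite eq_le remainder_ge0 // andbT leNgt; apply/negP => rem_gt0.
have cs_simple : {in cs, forall c, is_simple_cycle c}.
  by move=> c; rewrite csE.
have [c csimple cpos] := active_simple_cycle (remainder_ge0 cs f0)
  (remainder_circulation cs_simple fcirc) rem_gt0.
have ccs : c \in cs by rewrite csE.
have [|e' e'c rem'] := remainder_vanishes f0 ccs.
  by apply: contraTneq csimple => ->.
by have := cpos e' e'c; rewrite rem' ltxx.
Qed.

End Peeling.

(** * Real-valued integrals of functions known up to null sets *)

Section RintegralAe.
Context d (T : measurableType d) (R : realType).
Variable mu : {measure set T -> \bar R}.
Implicit Types (D : set T) (f : T -> R).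

Lemma integrableB_EFin D f1 f2 : measurable D ->
  mu.-integrable D (EFin \o f1) -> mu.-integrable D (EFin \o f2) ->
  mu.-integrable D (EFin \o (f1 \- f2)).
Proof. by move=> mD i1 i2; apply: eq_integrable (integrableB mD i1 i2). Qed.

Lemma Rintegral_sum (I : Type) (s : seq I) (P : pred I) (F : I -> T -> R) D :
  measurable D -> (forall i, mu.-integrable D (EFin \o F i)) ->
  \int[mu]_(x in D) (\sum_(i <- s | P i) F i x) =
  \sum_(i <- s | P i) \int[mu]_(x in D) F i x.
Proof.
move=> mD intF; rewrite /Rintegral.
under eq_integral do rewrite -sumEFin.
rewrite (@integral_sum _ _ _ mu _ mD _ (fun i => EFin \o F i)) //.
rewrite sum_fine // => i _.
by have := integrable_fin_num mD (intF i).
Qed.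

Lemma ae_eq_Rintegral D f g : measurable D ->
  measurable_fun D f -> measurable_fun D g ->
  {ae mu, forall x, D x -> f x = g x} ->
  \int[mu]_(x in D) f x = \int[mu]_(x in D) g x.
Proof.
move=> mD mf mg fg; congr fine; apply: ae_eq_integral => //.
- exact/measurable_EFinP.
- exact/measurable_EFinP.
- by apply: filterS fg => x fg /fg ->.
Qed.

(** Passing to the absolute value turns nonnegativity almost everywhere into nonnegativity
    everywhere. *)
Lemma Rintegral_normr_ae_ge0 D f : measurable D ->
  mu.-integrable D (EFin \o f) -> {ae mu, forall x, D x -> 0 <= f x} ->
  \int[mu]_(x in D) f x = \int[mu]_(x in D) `|f x|.
Proof.
move=> mD /integrableP[/measurable_EFinP mf _] f0.
apply: ae_eq_Rintegral => //; first exact: measurableT_comp.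
by apply: filterS f0 => x f0 /f0 fx; rewrite ger0_norm.
Qed.

Lemma Rintegral_ae_ge0 D f : measurable D ->
  mu.-integrable D (EFin \o f) -> {ae mu, forall x, D x -> 0 <= f x} ->
  0 <= \int[mu]_(x in D) f x.
Proof.
by move=> mD intf f0; rewrite Rintegral_normr_ae_ge0 //; apply: Rintegral_ge0.
Qed.

Lemma Rintegral_ae_eq0 D f : measurable D ->
  mu.-integrable D (EFin \o f) -> {ae mu, forall x, D x -> 0 <= f x} ->
  \int[mu]_(x in D) f x = 0 -> {ae mu, forall x, D x -> f x = 0}.
Proof.
move=> mD intf f0; rewrite Rintegral_normr_ae_ge0 // => int0.
have [mf _] := integrableP _ _ _ intf.
have /(ae_eq_integral_abs mu mD mf) : (\int[mu]_(x in D) `|(EFin \o f) x| = 0)%E.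
  have := integrable_fin_num mD (integrable_abse intf).
  by move/fineK <-; rewrite -[X in X%:E]/(\int[mu]_(x in D) `|f x|) int0.
by apply: filterS => x fx /fx [].
Qed.

Lemma Rintegral_all_eq0 D f : measurable D -> mu.-integrable D (EFin \o f) ->
  (forall E, measurable E -> E `<=` D -> \int[mu]_(x in E) f x = 0) ->
  {ae mu, forall x, D x -> f x = 0}.
Proof.
move=> mD intf int0.
have : ae_eq mu D (EFin \o f) (cst 0%E).
  apply: integral_ae_eq => // E ED mE; rewrite integral0.
  have := integrable_fin_num mE (integrableS mD mE ED intf).
  by move/fineK <-; rewrite -[X in X%:E]/(\int[mu]_(x in E) f x) int0.
by apply: filterS => x fx /fx [].
Qed.

End RintegralAe.

(* The library's hint fails to find the ring-of-sets structure carried by the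
   Lebesgue measure. *)
#[local] Hint Extern 0 (Filter (nbhs (almost_everywhere _))) =>
  exact: (ae_filter_ringOfSetsType (@lebesgue_measure _)) : typeclass_instances.

(** * Measurability and almost everywhere statements on the horizon *)

Section Horizon.
Variables (R : realType) (tf : R).
Notation mu := (@lebesgue_measure R).
Implicit Types (phi f : R -> R) (B : set R).

Lemma measurable_horizon : measurable (horizon tf).
Proof. by rewrite (_ : horizon tf = `[0, tf]%classic). Qed.

Lemma measurable_preimage_on phi B : 0 <= tf ->
  (forall t t', horizon tf t -> horizon tf t' -> t <= t' -> phi t <= phi t') ->
  measurable B -> measurable (preimage_on tf phi B).
Proof.
move=> tf0 phi_mono mB.
(* Monotonicity of [phi] is known on the horizon only; composing with the projection onto it gives a
   function nondecreasing on the whole line. *)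
pose clamp x : R := Num.max 0 (Num.min x tf).
have clampH x : horizon tf (clamp x).
  by rewrite /horizon /= le_max lexx ge_max tf0 ge_min lexx orbT.
have clamp_id x : horizon tf x -> clamp x = x.
  by case/andP=> x0 xtf; rewrite /clamp (min_idPl xtf) (max_idPr x0).
have -> : preimage_on tf phi B = horizon tf `&` (phi \o clamp) @^-1` B.
  by apply/seteqP; split => x [Hx] /=; rewrite clamp_id.
suff mphi : measurable_fun (horizon tf) (phi \o clamp).
  exact: mphi measurable_horizon _ mB.
apply: nondecreasing_measurable; first exact: measurable_horizon.
move=> x y xy /=.
apply: phi_mono => //; rewrite /clamp ge_max le_max lexx /= le_max.
by rewrite le_min !ge_min xy lexx !orbT.
Qed.

Lemma in_L_sub f B : in_L tf f -> measurable B -> B `<=` horizon tf ->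
  mu.-integrable B (EFin \o f).
Proof.
by move=> intf mB BH; apply: integrableS intf => //; apply: measurable_horizon.
Qed.

Lemma ae_on_sub (P : R -> Prop) B :
  ae_on tf P -> B `<=` horizon tf -> {ae mu, forall x, B x -> P x}.
Proof. by rewrite /ae_on => aeP BH; apply: filterS aeP => x Px /BH /Px. Qed.

Lemma ae_onS (P Q : R -> Prop) :
  (forall t, P t -> Q t) -> ae_on tf P -> ae_on tf Q.
Proof. by rewrite /ae_on => PQ aeP; apply: filterS aeP => t Pt /Pt /PQ. Qed.

Lemma ae_onI (P Q : R -> Prop) :
  ae_on tf P -> ae_on tf Q -> ae_on tf (fun t => P t /\ Q t).
Proof.
rewrite /ae_on => aeP aeQ.
by apply: filterS2 aeP aeQ => x Px Qx Hx; split; [exact: Px | exact: Qx].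
Qed.

Lemma ae_on_forall (I : finType) (P : I -> R -> Prop) :
  (forall i, ae_on tf (P i)) -> ae_on tf (fun t => forall i, P i t).
Proof.
rewrite /ae_on => aeP; have allP : {ae mu, forall x i, horizon tf x -> P i x}.
  exact: filter_forall.
by apply: filterS allP => x Px Hx i; apply: Px.
Qed.

End Horizon.

(** * Flow in transit and the absence of delay *)

Section Network.
Variables (R : realType) (G : digraph) (tf : R) (htf : 0 < tf).
Variable D : edge G -> R -> R.
Hypothesis D_ge0 : forall e t, horizon tf t -> 0 <= D e t.
Hypothesis T_mono : forall e t t', horizon tf t -> horizon tf t' -> t <= t' ->
  exit_time D e t <= exit_time D e t'.
Variable g : edge G -> R -> R.
Hypothesis gL : forall e, in_Lplus tf (g e).
Notation mu := (@lebesgue_measure R).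

Let mpre e B : measurable B -> measurable (preimage_on tf (exit_time D e) B).
Proof. by apply: measurable_preimage_on; [apply: ltW | apply: T_mono]. Qed.

(** Each edge has one tail and one head, so both double sums regroup into sums over all edges. *)
Lemma sum_node_balance B : \sum_v node_balance tf D g v B =
  \sum_e (\int[mu]_(x in B) g e x -
          \int[mu]_(x in preimage_on tf (exit_time D e) B) g e x).
Proof.
rewrite /node_balance !sumrB; congr (_ - _).
  by rewrite [RHS](partition_big (@tail G) xpredT).
by rewrite [RHS](partition_big (@head G) xpredT).
Qed.

Let initial_pre e t : horizon tf t ->
  preimage_on tf (exit_time D e) (horizon t) `<=` horizon t.
Proof.
move=> /andP[_ ttf] x [Hx /andP[_ Tx]]; have /andP[x0 _] := Hx.
apply/andP; split=> //; apply: le_trans Tx; rewrite lerDl; exact: D_ge0.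
Qed.

(** Here [horizon t] serves as the interval from 0 to [t]. Since delays are nonnegative, flow that
    has left [e] by time [t] also entered by then; the difference is the flow in transit on [e]. *)
Lemma initial_balance e t : horizon tf t ->
  \int[mu]_(x in horizon t) g e x -
  \int[mu]_(x in preimage_on tf (exit_time D e) (horizon t)) g e x =
  \int[mu]_(x in [set x | x <= t < exit_time D e x] `&` horizon tf) g e x.
Proof.
move=> Ht; have /andP[t0 ttf] := Ht.
set P := preimage_on _ _ _.
have -> : [set x | x <= t < exit_time D e x] `&` horizon tf =
          horizon t `\` P.
  apply/seteqP; split => x /=.
    move=> [/andP[xt tT] Hx]; have /andP[x0 _] := Hx.
    split; first exact/andP.
    by move=> [_ /andP[_]] /=; rewrite leNgt tT.
  move=> [/andP[x0 xt] nP].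
  have Hx : horizon tf x by apply/andP; split=> //; apply: le_trans ttf.
  split=> //; rewrite xt ltNge; apply/negP => Tt; apply: nP; split=> //.
  by apply/andP; split=> //; rewrite addr_ge0 // D_ge0.
have mH := @measurable_horizon R t.
have mP : measurable P := mpre e mH.
rewrite -{1}(setDUK (initial_pre (e := e) Ht)) Rintegral_setU //.
- by rewrite addrAC subrr add0r.
- exact: measurableD.
- rewrite setDUK; last exact: initial_pre.
  apply: in_L_sub => //; first exact: (gL e).1.
  by move=> x /andP[x0 xt]; apply/andP; split=> //; apply: le_trans ttf.
- by apply/disj_setPS => x [? []].
Qed.

(* A positive delay is in progress at some rational time, so countably many null
   sets suffice. *)
Lemma no_delay_on_flow :
  (forall t, horizon tf t -> \sum_v node_balance tf D g v (horizon t) <= 0) ->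
  forall e, ae_on tf (fun t => 0 < g e t -> D e t = 0).
Proof.
move=> balance_le0 e.
pose S (q : rat) := [set x | x <= ratr q < exit_time D e x] `&` horizon tf.
have mS e' t : horizon tf t ->
    measurable ([set x | x <= t < exit_time D e' x] `&` horizon tf).
  move=> Ht.
  have -> : [set x | x <= t < exit_time D e' x] `&` horizon tf =
     preimage_on tf (exit_time D e') `]t, +oo[%classic `&` `]-oo, t]%classic.
    apply/seteqP; rewrite /preimage_on; split => x /=; rewrite !in_itv /= andbT.
      by move=> [/andP[-> ->]].
    by move=> [[? ->] ->].
  by apply: measurableI => //; apply: mpre.
have SH e' t : [set x | x <= t < exit_time D e' x] `&` horizon tf
               `<=` horizon tf by move=> ? [].
have gap_ge0 e' t : horizon tf t -> 0 <=
    \int[mu]_(x in [set x | x <= t < exit_time D e' x] `&` horizon tf) g e' x.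
  move=> Ht; have [intg g0] := gL e'.
  apply: Rintegral_ae_ge0; first exact: mS Ht.
    exact: in_L_sub intg (mS _ _ Ht) (SH _ _).
  exact: ae_on_sub g0 (SH _ _).
have S0 q : {ae mu, forall x, horizon tf (ratr q) -> S q x -> g e x = 0}.
  have [Hq|nHq] := pselect (horizon tf (ratr q)); last first.
    by apply: filterE => x /nHq.
  have [intg g0] := gL e.
  have /filterS : {ae mu, forall x, S q x -> g e x = 0}; last by apply=> x ? _.
  apply: Rintegral_ae_eq0.
  - exact: mS Hq.
  - exact: in_L_sub intg (mS _ _ Hq) (SH _ _).
  - exact: ae_on_sub g0 (SH _ _).
  have := balance_le0 _ Hq; rewrite sum_node_balance.
  under eq_bigr do rewrite initial_balance //.
  move=> sum_le0.
  (* The amounts in transit are nonnegative and their sum is nonpositive, so each one vanishes. *)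
  have /eqP : \sum_e' \int[mu]_(x in [set x | x <= (ratr q : R) < exit_time D e' x]
      `&` horizon tf) g e' x = 0.
    by apply/eqP; rewrite eq_le sum_le0 sumr_ge0 // => e' _; exact: gap_ge0.
  rewrite psumr_eq0; last by move=> e' _; exact: gap_ge0.
  by move/allP => /(_ e); rewrite mem_index_enum => /(_ isT) /eqP.
(* The rationals are enumerated by [unpickle], so that a countable intersection over [nat]
   applies. *)
have S0all : {ae mu, forall x, forall n : nat, forall q : rat,
    unpickle n = Some q -> horizon tf (ratr q) -> S q x -> g e x = 0}.
  apply: ae_foralln => n.
  case: (unpickle n : option rat) => [q|]; last by apply: filterE.
  by apply: filterS (S0 q) => x gx _ [<-].
have ntf : {ae mu, forall x, x <> tf}.
  exists [set tf]; split => //; first exact: lebesgue_measure_set1.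
  by move=> x /= /contrapT.
apply: filterS2 S0all ntf => x gx xtf Hx gpos.
have /andP[x0 xtf'] := Hx.
apply/eqP; rewrite eq_le D_ge0 // andbT leNgt; apply/negP => Dpos.
(* The rational time must lie in the horizon as well as before the exit, hence the minimum with [tf]
   and the exclusion of the single point [tf]. *)
have xlt : x < Num.min tf (exit_time D e x).
  by rewrite lt_min lt_neqAle xtf' ltrDl Dpos !andbT; apply/eqP.
have [q] := rat_in_itvoo xlt; rewrite in_itv /= lt_min => /and3P[xq qtf qT].
have g0 := gx (pickle q) q (pickleK q); move: gpos; rewrite g0 ?ltxx //.
  by apply/andP; split; [apply: le_trans (ltW xq) | apply: ltW].
by split=> //=; rewrite (ltW xq).
Qed.

(** * Pointwise conservation in the absence of delay *)

Section NoDelay.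
Hypothesis no_delay : forall e, ae_on tf (fun t => 0 < g e t -> D e t = 0).

(** At almost every time, either [g e] is zero or the exit time is the entry time; in both cases the
    two restrictions of [g e] agree. *)
Lemma Rintegral_preimage_no_delay e B : measurable B -> B `<=` horizon tf ->
  \int[mu]_(x in preimage_on tf (exit_time D e) B) g e x =
  \int[mu]_(x in B) g e x.
Proof.
move=> mB BH; have [intg g0] := gL e.
have mg (E : set R) : measurable E -> E `<=` horizon tf ->
    measurable_fun setT (g e \_ E).
  move=> mE EH; apply: (proj1 (measurable_restrictT _ mE)).
  by have /(measurable_int mu) /measurable_EFinP := in_L_sub intg mE EH.
rewrite Rintegral_mkcond [RHS]Rintegral_mkcond; apply: ae_eq_Rintegral => //.
- by apply: mg; [exact: mpre | move=> x []].
- exact: mg.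
have := ae_onI g0 (no_delay e); rewrite /ae_on => g0nd.
apply: filterS g0nd => x gx _.
have [/gx [{}gx nd]|nHx] := pselect (horizon tf x); last first.
  by rewrite !patchE memNset; [rewrite memNset // => /BH | case].
rewrite !patchE; have [->|gN0] := eqVneq (g e x) 0; first by rewrite !if_same.
have Dx : D e x = 0 by apply: nd; rewrite lt_def gN0.
have Tx : exit_time D e x = x by rewrite /exit_time Dx addr0.
congr (if _ then _ else _); apply/idP/idP => /set_mem.
  by move=> [_ BTx]; apply/mem_set; rewrite -Tx.
by move=> Bx; apply/mem_set; split; [exact: BH | rewrite /= Tx].
Qed.

(** Preimages may be replaced by [B] itself, so the static balance has integral zero over every
    measurable [B] in the horizon and vanishes almost everywhere. *)
Lemma static_conservation v : flow_conservation tf D g v ->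
  ae_on tf (fun t => \sum_(e | tail e == v) g e t = \sum_(e | head e == v) g e t).
Proof.
move=> fc.
have mH := @measurable_horizon R tf.
have intS (p : edge G -> node G) B : measurable B -> B `<=` horizon tf ->
    mu.-integrable B (EFin \o fun x => \sum_(e | p e == v) g e x).
  move=> mB BH.
  rewrite (_ : EFin \o _ = fun x => (\sum_(e | p e == v) (EFin \o g e) x)%E).
    by apply: integrable_sum => // e _; apply: in_L_sub (gL e).1 mB BH.
  by apply/funext => x /=; rewrite sumEFin.
have : {ae mu, forall x, horizon tf x ->
    \sum_(e | tail e == v) g e x - \sum_(e | head e == v) g e x = 0}.
  apply: Rintegral_all_eq0 => //.
    by apply: integrableB_EFin => //; apply: intS.
  move=> B mB BH; have intg e := in_L_sub (gL e).1 mB BH.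
  rewrite RintegralB //; [|exact: intS|exact: intS].
  rewrite !Rintegral_sum //; have := fc B mB BH.
  rewrite Rintegral_cst // mul0r /node_balance => bal0.
  rewrite -[RHS]bal0; congr (_ - _).
  by apply: eq_bigr => e _; rewrite Rintegral_preimage_no_delay.
by apply: filterS => x gx /gx /eqP; rewrite subr_eq0 => /eqP.
Qed.

End NoDelay.
End Network.

(* At [d] conservation follows from that at all other nodes, since the static
   balances sum up to zero. *)
Lemma ae_static_circulation (R : realType) (G : digraph) (tf : R)
    (D : edge G -> R -> R) (g : edge G -> R -> R) (d : node G) : 0 < tf ->
  (forall e t, horizon tf t -> 0 <= D e t) ->
  (forall e t t', horizon tf t -> horizon tf t' -> t <= t' ->
     exit_time D e t <= exit_time D e t') ->
  (forall e, in_Lplus tf (g e)) ->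
  (forall v, v != d -> flow_conservation tf D g v) ->
  (forall B, measurable B -> B `<=` horizon tf -> node_balance tf D g d B <= 0) ->
  ae_on tf (fun t => [/\ forall e, 0 <= g e t,
    forall e, 0 < g e t -> D e t = 0 & static_circulation (g^~ t)]).
Proof.
move=> tf0 D0 Tmono gL fc dle0.
have no_delay : forall e, ae_on tf (fun t => 0 < g e t -> D e t = 0).
  apply: (no_delay_on_flow tf0 D0 Tmono gL) => t Ht.
  have /andP[_ ttf] := Ht.
  have mt := @measurable_horizon R t.
  have tH : horizon t `<=` horizon tf.
    by move=> x /andP[x0 xt]; apply/andP; split=> //; apply: le_trans ttf.
  rewrite (bigD1 d) //= big1 ?addr0; first exact: dle0.
  by move=> v vd; rewrite fc // Rintegral_cst // mul0r.
have cons : ae_on tf (fun t => forall v, v != d ->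
    \sum_(e | tail e == v) g e t = \sum_(e | head e == v) g e t).
  apply: ae_on_forall => v; case: (eqVneq v d) => [_|vd].
    by rewrite /ae_on; apply: filterE.
  by apply: ae_onS (static_conservation tf0 Tmono gL no_delay (fc v vd)).
have g0 : ae_on tf (fun t => forall e, 0 <= g e t).
  by apply: ae_on_forall => e; have [] := gL e.
apply: ae_onS (ae_onI g0 (ae_onI (ae_on_forall no_delay) cons)).
move=> t [g0t [ndt const]]; split=> // v.
case: (eqVneq v d) => [->|]; last exact: const.
have : \sum_v \sum_(e | tail e == v) g e t = \sum_v \sum_(e | head e == v) g e t.
  transitivity (\sum_e g e t); first by rewrite [RHS](partition_big (@tail G) xpredT).
  by rewrite [LHS](partition_big (@head G) xpredT).
rewrite (bigD1 d) //= [RHS](bigD1 d) //=.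
by rewrite [X in _ + X](eq_bigr _ const) => /addIr.
Qed.

(** * Measurability of the peeled amounts and edge flows along cycles without delay *)

Lemma measurable_peeled d (T : measurableType d) (R : realType) (G : digraph)
    (A : set T) (cs : seq (seq (edge G))) c (f : edge G -> T -> R) :
  (forall e, measurable_fun A (f e)) ->
  measurable_fun A (fun t => peeled cs (f^~ t) c).
Proof.
have mbottleneck (c' : seq (edge G)) (f' : edge G -> T -> R) :
    (forall e, measurable_fun A (f' e)) ->
    measurable_fun A (fun t => bottleneck (f'^~ t) c').
  case: c' => [|e p] mf; first exact: measurable_cst.
  rewrite /bottleneck; elim: p => [|e' p IHp].
    by under eq_fun do rewrite big_nil; apply: mf.
  by under eq_fun do rewrite big_cons; apply: measurable_minr.
elim: cs f => [|c0 cs IHcs] f mf /=; first exact: measurable_cst.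
case: (c == c0); first exact: mbottleneck.
(* The residual after [c0] is again a family of functions of time indexed by edges, to which the
   induction hypothesis applies. *)
apply: (IHcs (fun e t => peel (f^~ t) c0 e)) => e; rewrite /peel.
apply: measurable_funB => //; case: (e \in c0); last exact: measurable_cst.
exact: mbottleneck.
Qed.

Lemma arrival_no_delay (R : realType) (G : digraph) (D : edge G -> R -> R)
    (w : seq (edge G)) j t :
  (forall e, e \in w -> D e t = 0) -> arrival D w j t = t.
Proof.
rewrite /arrival => D0.
have : forall e, e \in take j w -> D e t = 0 by move=> e /mem_take /D0.
elim: (take j w) => //= e p IHp Dp.
rewrite {2}/exit_time Dp ?mem_head // addr0 IHp // => e' e'p.
by apply: Dp; rewrite inE e'p orbT.
Qed.

(** Wherever [h] is nonzero, every arrival time is the identity, so each position of [e] contributes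
    the same integral of [h]; by [uniq c] there is at most one such position. Asking for zero delay
    at all times, not almost all, makes the integrands equal as functions. *)
Lemma edge_flow_no_delay (R : realType) (G : digraph) (tf : R)
    (D : edge G -> R -> R) (c : seq (edge G)) (h : R -> R) (e : edge G) :
  uniq c -> in_L tf h ->
  (forall t, h t != 0 -> horizon tf t /\ forall e, e \in c -> D e t = 0) ->
  is_edge_flow tf D c e h (fun t => if e \in c then h t else 0).
Proof.
move=> uc intH h_no_delay; split.
  by case: (e \in c) => //; apply: (integrable0 (@lebesgue_measure R)).
move=> t Ht.
have int_pre j : \int[lebesgue_measure]_(x in
    preimage_on tf (arrival D c j) [set x : R | (0 <= x <= t)%R]) h x =
    \int[lebesgue_measure]_(x in [set x : R | (0 <= x <= t)%R]) h x.
  rewrite Rintegral_mkcond [RHS]Rintegral_mkcond; congr Rintegral.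
  apply/funext => x; rewrite !patchE.
  have [->|hx] := eqVneq (h x) 0; first by rewrite !if_same.
  have [Hx Dx] := h_no_delay x hx.
  congr (if _ then _ else _); apply/idP/idP => /set_mem.
    by move=> [_]; rewrite /= arrival_no_delay // => ?; apply/mem_set.
  by move=> xt; apply/mem_set; split=> //=; rewrite arrival_no_delay.
under [RHS]eq_bigr do rewrite int_pre.
case: (boolP (e \in c)) => ec; last first.
  rewrite Rintegral_cst ?mul0r; last exact: measurable_horizon.
  rewrite big_pred0 // => j; apply/negP => /eqP je.
  by move: ec; rewrite -je mem_nth.
have ic : (index e c < size c)%N by rewrite index_mem.
rewrite (big_pred1 (Ordinal ic)) // => j.
by rewrite /= -{2}(nth_index e ec) nth_uniq.
Qed.

(** * From the pointwise decomposition to the inflow rates *)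

Theorem theorem3p17 (R : realType) (G : digraph) (s d : node G)
  (hs : forall v : node G, reachable s v)
  (tf : R) (htf : 0 < tf)
  (D : (edge G -> R -> R) -> edge G -> R -> R)
  (u : edge G -> R -> R)
  (hu : forall e, in_L tf (u e))
  (hD0 : forall e t, horizon tf t -> 0 <= D u e t)
  (hDac : forall e, absolutely_continuous_on 0 tf (D u e))
  (hTmono : forall e t t', horizon tf t -> horizon tf t' -> t <= t' ->
     exit_time (D u) e t <= exit_time (D u) e t')
  (huvanish : exists tf' : R, 0 <= tf' < tf /\
     forall e, ae_on tf (fun t => tf' <= t -> u e t = 0))
  (hA : forall (w : seq (edge G)) (j : nat) (t : R),
     is_walk w -> (j < size w)%N -> horizon tf t ->
     horizon tf (arrival (D u) w j t))
  (g : edge G -> R -> R)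
  (hg : is_sd_flow tf (D u) s d g)
  (hgs : flow_conservation tf (D u) g s) :
  exists h : {bseq #|node G| of edge G} -> R -> R,
    (forall c, c \in simple_cycles G -> zero_cycle_inflow tf (D u) c (h c)) /\
    exists l : {bseq #|node G| of edge G} -> edge G -> R -> R,
      (forall c e, c \in simple_cycles G ->
         is_edge_flow tf (D u) c e (h c) (l c e)) /\
      forall e : edge G,
        ae_on tf (fun t => g e t = \sum_(c in simple_cycles G) l c e t) /\
        ae_on tf (fun t =>
          g e t = \sum_(c in simple_cycles G | e \in (c : seq (edge G))) h c t).
Proof.
have [gL _ fc dle0] := hg.
have fc' v : v != d -> flow_conservation tf (D u) g v.
  by move=> vd; case: (eqVneq v s) => [->|vs]; [exact: hgs | exact: fc].
have mH := @measurable_horizon R tf.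
have [N [mN N0 badN]] := ae_static_circulation htf hD0 hTmono gL fc' dle0.
(* The times where some property fails are only known to lie in the null set [N]; removing all of
   [N], which is measurable, keeps [A] measurable. *)
pose A := horizon tf `\` N.
have mA : measurable A by apply: measurableD.
(* Vanishing off [A] makes every property below hold at all times. *)
pose f e : R -> R := g e \_ A.
have good t : A t -> [/\ forall e, 0 <= g e t,
    forall e, 0 < g e t -> D u e t = 0 & static_circulation (g^~ t)].
  by move=> [Ht Nt]; apply: contrapT => bad; apply: Nt; apply: badN => /(_ Ht).
have fA t e : A t -> f e t = g e t by move=> At; rewrite /f patchE mem_set.
have fNA t e : ~ A t -> f e t = 0 by move=> At; rewrite /f patchE memNset.
have f0 t e : 0 <= f e t.
  have [At|At] := pselect (A t); last by rewrite fNA.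
  by rewrite fA //; have [+ _ _] := good t At; apply.
have f_circ t : static_circulation (f^~ t).
  move=> v; have [At|At] := pselect (A t); last first.
    by rewrite !big1 // => e _; exact: fNA.
  under eq_bigr do rewrite fA //; under [RHS]eq_bigr do rewrite fA //.
  by have [_ _] := good t At; apply.
have f_no_delay t e : 0 < f e t -> horizon tf t /\ D u e t = 0.
  have [At|At] := pselect (A t); last by rewrite fNA // ltxx.
  rewrite fA // => gpos; split; first exact: At.1.
  by have [_ nd _] := good t At; exact: nd.
have mf e : measurable_fun (horizon tf) (f e).
  apply: (proj1 (measurable_restrict (g e) mA mH)).
  have mg : measurable_fun (horizon tf) (g e).
    by have /(measurable_int _) /measurable_EFinP := (gL e).1.
  exact: measurable_funS mH (@subIsetl _ _ _) mg.
have intf e : in_L tf (f e).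
  apply: le_integrable (gL e).1; first exact: mH.
    by apply/measurable_EFinP; exact: mf.
  move=> t _ /=; rewrite lee_fin /f patchE; case: ifP => // _.
  by rewrite normr0.
have ae_fg e : ae_on tf (fun t => g e t = f e t).
  exists N; split=> // t /= bad; apply: contrapT => Nt; apply: bad => Ht.
  by rewrite fA.
pose cs := [seq val c | c <- enum (simple_cycles G)].
have ucs : uniq cs by rewrite map_inj_uniq ?enum_uniq //; exact: val_inj.
(* The length bound built into the type excludes no simple cycle, by [size_simple_cycle]. *)
have csE : cs =i @is_simple_cycle G.
  move=> c; apply/mapP/idP => [[c' + ->]|sc]; first by rewrite mem_enum inE.
  by exists (Bseq (size_simple_cycle sc)); rewrite ?mem_enum ?inE.
pose h (c : {bseq #|node G| of edge G}) t := peeled cs (f^~ t) c.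
have h0 c t : 0 <= h c t by apply: peeled_ge0.
have hf (c : {bseq #|node G| of edge G}) e t : e \in (c : seq (edge G)) -> h c t <= f e t.
  by move=> ec; exact: (peeled_le cs (f0 t) ec).
have hdecomp e t :
    f e t = \sum_(c in simple_cycles G | e \in (c : seq (edge G))) h c t.
  rewrite (peeled_decomposition e ucs csE (f0 t) (f_circ t)) big_map.
  by rewrite big_enum_cond.
have cycle_edge (c : {bseq #|node G| of edge G}) : c \in simple_cycles G -> exists e, e \in (c : seq (edge G)).
  rewrite inE; case: c => -[|e p] //= _ _; exists e; exact: mem_head.
have hL c : c \in simple_cycles G -> in_L tf (h c).
  move=> /cycle_edge[e ec]; apply: le_integrable (intf e); first exact: mH.
    by apply/measurable_EFinP; exact: measurable_peeled.
  by move=> t _ /=; rewrite lee_fin !ger0_norm ?hf.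
have h_no_delay c t : c \in simple_cycles G -> h c t != 0 ->
    horizon tf t /\ forall e, e \in (c : seq (edge G)) -> D u e t = 0.
  move=> /cycle_edge[e0 e0c] hct.
  (* Positive inflow into [c] forces positive flow on every edge of [c], hence zero delay on all of
     them. *)
  have fpos e : e \in (c : seq (edge G)) -> 0 < f e t.
    by move=> ec; apply: lt_le_trans (hf c e t ec); rewrite lt_def hct h0.
  split; first exact: (f_no_delay t e0 (fpos e0 e0c)).1.
  by move=> e ec; exact: (f_no_delay t e (fpos e ec)).2.
have aeT (P : R -> Prop) : (forall t, P t) -> ae_on tf P.
  by move=> PT; rewrite /ae_on; apply: filterE.
exists h; split.
  move=> c sc; split; first by split; [exact: hL | apply: aeT].
  apply: aeT => t; rewrite lt_def => /andP[hct _].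
  exact: (h_no_delay c t sc hct).2.
exists (fun (c : {bseq #|node G| of edge G}) e t => if e \in (c : seq (edge G)) then h c t else 0); split.
  move=> c e sc; apply: edge_flow_no_delay; last by move=> t; apply: h_no_delay.
    by move: sc; rewrite inE => /uniq_tail_simple_cycle /map_uniq.
  exact: hL.
move=> e; split; apply: ae_onS (ae_fg e) => t ->; last exact: hdecomp.
by rewrite hdecomp big_mkcondr.
Qed.
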